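(* Let $p\ge 2$, let $q$ be a positive integer, let $j\in\{1,\ldots,p\}$, and let $S\subset \mathbb{N}^p$ be the affine semigroup $\mathbb{N}^p\setminus \{e_j,2e_j,\ldots ,(q-1)e_j\}$. Then $S$ satisfies the extended Wilf's conjecture, that is, $\mathrm{n}(S)\cdot \mathrm{e}(S)\geq \mathcal{N}(\mathrm{Fb}(S))+1$, for every monomial order $\prec$ on $\mathbb{N}^p$ such that every element of $\mathbb{N}^p$ is preceded by only finitely many elements.
   Context: $\mathbb{N}$ is the set of nonnegative integers and $\{e_1,\ldots,e_p\}$ is the standard basis of $\mathbb{N}^p$. For $q=1$ the removed set is empty. An affine semigroup is a finitely generated submonoid of $(\mathbb{N}^p,+)$; it has a unique minimal generating set (as a monoid), whose cardinality is its embedding dimension $\mathrm{e}(S)$. An $\mathbb{N}^p$-semigroup is an affine semigroup $S\subset\mathbb{N}^p$ such that $\mathcal{H}(S)=\mathbb{N}^p\setminus S$ is finite. A monomial order $\prec$ on $\mathbb{N}^p$ is a total order such that $a\preceq b$ implies $a+c\preceq b+c$ for all $c\in\mathbb{N}^p$, and $0\preceq c$ for all $c\in\mathbb{N}^p$. The genus is $\mathrm{g}(S)=|\mathcal{H}(S)|$; the Frobenius element $\mathrm{Fb}(S)$ is the maximum of $\mathcal{H}(S)$ with respect to $\prec$ (with the convention $\mathrm{Fb}(\mathbb{N}^p)=(-1,\ldots,-1)$, preceding all elements of $\mathbb{N}^p$); $\mathrm{n}(S)$ is the cardinality of $\{x\in S\mid x\prec \mathrm{Fb}(S)\}$; and the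 Frobenius number is $\mathcal{N}(\mathrm{Fb}(S))=\mathrm{n}(S)+\mathrm{g}(S)-1$. Thus the extended Wilf inequality reads $\mathrm{n}(S)\,\mathrm{e}(S)\ge \mathrm{n}(S)+\mathrm{g}(S)$. *)

(* Defs.v *)
From HB Require Import structures.
From mathcomp Require Import all_boot all_order all_algebra.
From mathcomp Require Import finmap.
From mathcomp Require Import boolp classical_sets functions cardinality.
From mathcomp Require Import zify.

Set Implicit Arguments.
Unset Strict Implicit.
Unset Printing Implicit Defensive.

Import Order.TTheory GRing.Theory Num.Theory.

Local Open Scope classical_set_scope.
Local Open Scope ring_scope.

Notation Np p := {ffun 'I_p -> nat}.

(* [fset_set A] is empty when [A] is infinite; [set_size] is meant for finite
   sets, and is only applied below to sets that are finite for an
   N^p-semigroup and an order with finite initial segments. *)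
Definition set_size (T : choiceType) (A : set T) : nat := #|` fset_set A|.

Definition submonoid p (M : set (Np p)) : Prop :=
  M 0 /\ forall x y, M x -> M y -> M (x + y).

Definition generated p (A : set (Np p)) : set (Np p) :=
  smallest (@submonoid p) A.

Definition minimal_generating_set p (S A : set (Np p)) : Prop :=
  generated A = S /\ forall B, B `<=` A -> generated B = S -> B = A.

Definition affine_semigroup p (S : set (Np p)) : Prop :=
  exists2 A, finite_set A & generated A = S.

Record Np_semigroup p := MkNpSemigroup {
  carrier :> set (Np p);
  carrier_affine : affine_semigroup carrier;
  carrier_cofinite : finite_set (~` carrier)
}.

Definition gaps p (S : Np_semigroup p) : set (Np p) := ~` S.

Definition genus p (S : Np_semigroup p) : nat := set_size (gaps S).

(* An affine semigroup has a unique minimal generating set, so the choice made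
   by [xget] is forced. *)
Definition embedding_dim p (S : Np_semigroup p) : nat :=
  set_size (xget set0 [set A | minimal_generating_set S A]).

Definition monomial_order p (le : rel (Np p)) : Prop :=
  [/\ [/\ reflexive le, antisymmetric le, transitive le & total le],
      forall a b c, le a b -> le (a + c) (b + c) &
      forall c, le 0 c].

Definition strict p (le : rel (Np p)) : rel (Np p) :=
  fun x y => le x y && (x != y).

Definition finitely_preceded p (le : rel (Np p)) : Prop :=
  forall x, finite_set [set y | strict le y x].

(* [Some f] is a Frobenius element [f] in N^p; [None] stands for the
   conventional value (-1, ..., -1) attained when there is no gap, of which
   only its position below all of N^p in the order is ever used. *)
Definition frobenius p (le : rel (Np p)) (S : Np_semigroup p) :
    option (Np p) :=
  xget None
    (Some @` [set f | gaps S f /\ forall h, gaps S h -> le h f]).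

Definition before_frobenius p (le : rel (Np p)) (S : Np_semigroup p)
    (x : Np p) : bool :=
  if frobenius le S is Some f then strict le x f else false.

Definition n_sporadic p (le : rel (Np p)) (S : Np_semigroup p) : nat :=
  set_size (S `&` [set x | before_frobenius le S x]).

(* Integer-valued: it is -1 when the semigroup is all of N^p. *)
Definition frobenius_number p (le : rel (Np p)) (S : Np_semigroup p) : int :=
  (n_sporadic le S)%:Z + (genus S)%:Z - 1.

Definition extended_wilf p (le : rel (Np p)) (S : Np_semigroup p) : Prop :=
  frobenius_number le S + 1 <=
    (n_sporadic le S)%:Z * (embedding_dim S)%:Z.

Definition std_basis p (j : 'I_p) : Np p := [ffun i => (i == j : nat)].

Definition axis_points p (j : 'I_p) (q : nat) : set (Np p) :=
  [set x | exists2 k, (1 <= k <= q - 1)%N & x = std_basis j *+ k].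

Lemma std_basis_mulrnE p (j : 'I_p) k i :
  (std_basis j *+ k) i = if i == j then k else 0%N.
Proof.
rewrite ffunMnE ffunE; case: eqP => _ /=; last by rewrite mul0rn.
by rewrite natn.
Qed.

Lemma axis_points_finite p (j : 'I_p) q : finite_set (axis_points j q).
Proof.
apply: (@sub_finite_set _ _ ((fun k => std_basis j *+ k) @` `I_q)).
  move=> _ [k hk ->]; exists k => //=; lia.
by apply: finite_image; exact: finite_II.
Qed.

Lemma axis_pointsP p (j : 'I_p) q (x : Np p) :
  axis_points j q x <->
    (forall i, i != j -> x i = 0%N) /\ (1 <= x j <= q - 1)%N.
Proof.
split=> [[k hk ->]|[x0 xj]].
  split=> [i /negbTE ij|]; by rewrite std_basis_mulrnE ?ij ?eqxx.
exists (x j) => //; apply/ffunP => i; rewrite std_basis_mulrnE.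
by case: eqVneq => [->//|/x0].
Qed.

Lemma axis_gap_submonoid p (j : 'I_p) q : submonoid (~` axis_points j q).
Proof.
split; first by move/axis_pointsP => [_]; rewrite ffunE.
move=> x y nx ny /axis_pointsP[xy0 xyj].
have xy i : i != j -> x i = 0%N /\ y i = 0%N.
  move=> /xy0; rewrite ffunE natrDE => /eqP.
  by rewrite addn_eq0 => /andP[/eqP-> /eqP->].
move: xyj; rewrite ffunE natrDE => xyj.
have [xj|xj] := posnP (x j).
  by apply: ny; apply/axis_pointsP; split=> [i /xy[]//|]; rewrite xj in xyj.
apply: nx; apply/axis_pointsP; split=> [i /xy[]//|].
by rewrite xj (leq_trans (leq_addr (y j) _))//; case/andP: xyj.
Qed.

Lemma box_finite p m : finite_set [set x : Np p | forall i, (x i <= m)%N].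
Proof.
pose f (y : {ffun 'I_p -> 'I_m.+1}) : Np p := [ffun i => y i : nat].
apply: (@sub_finite_set _ _ (f @` setT)); last exact/finite_image/finite_finset.
move=> x /= hx; exists [ffun i => inord (x i)] => //.
by apply/ffunP => i; rewrite !ffunE inordK// ltnS.
Qed.

Lemma generated_submonoid p (A : set (Np p)) : submonoid (generated A).
Proof.
split=> [M [[]]//|x y hx hy M [hM AM]].
by apply: hM.2; [apply: hx|apply: hy].
Qed.

Lemma axis_gap_affine p (j : 'I_p) q :
  affine_semigroup (~` axis_points j q).
Proof.
exists (~` axis_points j q `&` [set x | forall i, (x i <= q.+1.*2)%N]).
  exact/finite_setIr/box_finite.
set A := (X in generated X); apply/seteqP; split.
  by apply: smallest_sub; [exact: axis_gap_submonoid|move=> x []].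
move=> x; have [n] := ubnP (\sum_i x i)%N; elim: n x => // n IH x xn Sx.
have [xA|/existsNP[i xi]] := pselect (forall i, (x i <= q.+1.*2)%N).
  exact: sub_gen_smallest.
have {}xi : (q.+1.*2 < x i)%N by rewrite ltnNge; apply/negP.
pose y : Np p := [ffun k => if k == i then (x i - q.+1)%N else x k].
have -> : x = std_basis i *+ q.+1 + y.
  apply/ffunP => k; rewrite ffunE std_basis_mulrnE ffunE natrDE.
  by case: eqVneq => [->|//]; rewrite subnKC//; lia.
apply: (generated_submonoid A).2.
  apply: sub_gen_smallest; split=> [|k]; last first.
    by rewrite std_basis_mulrnE; case: ifP => _; lia.
  move=> /axis_pointsP[_]; rewrite std_basis_mulrnE.
  by case: ifP => _; lia.
apply: IH.
  rewrite (bigD1 i)//= in xn; rewrite (bigD1 i)//= ffunE eqxx.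
  rewrite (eq_bigr (fun k => x k)) => [|k /negbTE ki]; last by rewrite ffunE ki.
  by move: xn xi; set s := (\sum_(k | _) _)%N; lia.
move=> /axis_pointsP[y0 yj].
have [ij|ij] := eqVneq i j; last by move: (y0 _ ij); rewrite ffunE eqxx; lia.
by move: yj; rewrite ffunE -ij eqxx; lia.
Qed.

Lemma axis_gap_cofinite p (j : 'I_p) q :
  finite_set (~` ~` axis_points j q).
Proof. by rewrite setCK; exact: axis_points_finite. Qed.

Definition axis_gap_semigroup p (j : 'I_p) (q : nat) : Np_semigroup p :=
  MkNpSemigroup (axis_gap_affine j q) (axis_gap_cofinite j q).

(* Main.v *)
(* The multiples q e_j, ..., (2q-1) e_j cannot be written as sums of two nonzero
   elements of S, hence lie in every generating set, so e(S) >= q.  Since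
   g(S) = q - 1 and 0 is sporadic as soon as q > 1, the inequality
   n q >= n + q - 1, i.e. (n - 1)(q - 1) >= 0, suffices. *)
Require Import Defs.
From mathcomp Require Import all_boot all_order all_algebra.
From mathcomp Require Import finmap.
From mathcomp Require Import boolp classical_sets cardinality.
From mathcomp Require Import zify.

Set Implicit Arguments.
Unset Strict Implicit.
Unset Printing Implicit Defensive.

Import Order.TTheory GRing.Theory Num.Theory.

Local Open Scope classical_set_scope.
Local Open Scope ring_scope.

Lemma set_size_leq (T : choiceType) (A : set T) (s : seq T) :
  finite_set A -> (forall x, A x -> x \in s) -> (set_size A <= size s)%N.
Proof.
move=> finA As; apply: uniq_leq_size => [|x]; first exact: fset_uniq.
by rewrite in_fset_set// inE; exact: As.
Qed.

(** Finiteness is essential here: [fset_set] sends an infinite set to the empty one, so [set_size]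
    would be 0. *)
Lemma leq_set_size (T : choiceType) (A : set T) (s : seq T) :
  finite_set A -> uniq s -> (forall x, x \in s -> A x) ->
  (size s <= set_size A)%N.
Proof.
move=> finA us sA; apply: uniq_leq_size => // x xs.
by rewrite in_fset_set// inE; exact: sA.
Qed.

(** The irreducible elements; they turn out to be the minimal generating set, which makes
    [embedding_dim] accessible. *)
Definition atoms p (S : set (Np p)) : set (Np p) :=
  [set x | [/\ S x, x <> 0 &
    forall y z, S y -> S z -> x = y + z -> y = 0 \/ z = 0]].

(** Removing an atom x from S leaves a submonoid, since x is nonzero and is not a sum of two
    elements of S other than x. Generators that miss x would generate only elements of this smaller
    submonoid. *)
Lemma atoms_sub_generators p (S A : set (Np p)) :
  generated A = S -> atoms S `<=` A.
Proof.
move=> genA x [Sx x0 xirr]; apply: contrapT => nAx.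
have [S0 SD] : submonoid S by rewrite -genA; exact: generated_submonoid.
suff : generated A `<=` S `&` [set y | y <> x].
  by rewrite genA => /(_ x Sx)[].
apply: smallest_sub => [|y Ay]; last first.
  by split=> [|yx]; [rewrite -genA; exact: sub_gen_smallest|rewrite -yx in nAx].
split=> [|y z [Sy yx] [Sz zx]]; first by split=> // x0'; apply: x0.
split=> [|/esym xyz]; first exact: SD.
by case: (xirr y z Sy Sz xyz) => e; rewrite e ?add0r ?addr0 in xyz;
  [apply: zx|apply: yx].
Qed.

Lemma sum_coord_gt0 p (x : Np p) : x <> 0 -> (0 < \sum_i x i)%N.
Proof.
move=> x0; rewrite lt0n; apply/eqP => /eqP; rewrite sum_nat_eq0 => /forallP h.
by apply: x0; apply/ffunP => i; rewrite ffunE; exact/eqP/h.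
Qed.

Lemma sum_coordD p (x y : Np p) :
  (\sum_i (x + y)%R i = \sum_i x i + \sum_i y i)%N.
Proof. by rewrite -big_split/=; apply: eq_bigr => i _; rewrite ffunE. Qed.

(** Induction on the coordinate sum: a nonzero element of S that is not an atom splits into two
    nonzero elements of S, and both have a smaller sum. *)
Lemma generated_atoms p (S : set (Np p)) :
  submonoid S -> generated (atoms S) = S.
Proof.
move=> SM; apply/seteqP; split; first by apply: smallest_sub => // x [].
move=> x; have [n] := ubnP (\sum_i x i)%N; elim: n x => // n IH x xn Sx.
have [G0 GD] := generated_submonoid (atoms S).
have [->//|/eqP x0] := eqVneq x 0.
have [|nat_x] := pselect (atoms S x); first exact: sub_gen_smallest.
have [y [z [Sy Sz xyz y0 z0]]] :
    exists y z, [/\ S y, S z, x = y + z, y <> 0 & z <> 0].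
  apply: contrapT => nex; apply: nat_x; split=> // y z Sy Sz xyz.
  have [|y0] := pselect (y = 0); first by left.
  have [|z0] := pselect (z = 0); first by right.
  by case: nex; exists y, z.
have := sum_coord_gt0 y0; have := sum_coord_gt0 z0.
move: xn; rewrite xyz sum_coordD => xn z_gt0 y_gt0.
by apply: GD; apply: IH => //; lia.
Qed.

Lemma affine_submonoid p (S : set (Np p)) : affine_semigroup S -> submonoid S.
Proof. by move=> [A _ <-]; exact: generated_submonoid. Qed.

Lemma atoms_finite p (S : set (Np p)) :
  affine_semigroup S -> finite_set (atoms S).
Proof.
by move=> [A finA genA]; exact: sub_finite_set (atoms_sub_generators genA) finA.
Qed.

Lemma minimal_generating_setP p (S A : set (Np p)) :
  submonoid S -> minimal_generating_set S A <-> A = atoms S.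
Proof.
move=> SM; split=> [[genA minA]|->].
  by apply/esym/minA; [exact: atoms_sub_generators|exact: generated_atoms].
split=> [|B BA genB]; first exact: generated_atoms.
by apply/seteqP; split=> //; exact: atoms_sub_generators.
Qed.

Lemma embedding_dimE p (S : Np_semigroup p) :
  embedding_dim S = set_size (atoms S).
Proof.
have SM := affine_submonoid (carrier_affine S).
rewrite /embedding_dim; case: xgetP => [A _ /minimal_generating_setP->//|].
(* The fallback case of [xget] is impossible, because [atoms S] qualifies. *)
by move=> /(_ (atoms S)) []; exact/minimal_generating_setP.
Qed.

Lemma std_basis_mulrn_inj p (j : 'I_p) :
  injective (fun k => std_basis j *+ k).
Proof.
move=> k l /(congr1 (fun x : Np p => x j)).
by rewrite !std_basis_mulrnE eqxx.
Qed.

Lemma axis_gap_coord_ge p (j : 'I_p) q (x : Np p) :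
  ~ axis_points j q x -> (forall i, i != j -> x i = 0%N) -> x <> 0 ->
  (q <= x j)%N.
Proof.
move=> Sx xi0 x0; rewrite leqNgt; apply/negP => xq; apply: Sx.
apply/axis_pointsP; split=> //.
suff : x j != 0%N by lia.
apply/eqP => xj0; apply: x0; apply/ffunP => i; rewrite ffunE.
by have [->|/xi0] := eqVneq i j.
Qed.

(** Both summands of k e_j lie on the j-th axis; if both were nonzero, each would have j-th
    coordinate at least q, giving k >= 2q. *)
Lemma axis_gap_atom p (j : 'I_p) q k : (0 < q <= k)%N -> (k < q.*2)%N ->
  atoms (axis_gap_semigroup j q) (std_basis j *+ k).
Proof.
move=> qk k2q; split=> [/axis_pointsP[_]|k0|y z Sy Sz kyz].
- by rewrite std_basis_mulrnE eqxx; lia.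
- suff : k = 0%N by lia.
  by apply: (@std_basis_mulrn_inj _ j); rewrite mulr0n.
have coordE i : ((if i == j then k else 0) = y i + z i)%N.
  by rewrite -(std_basis_mulrnE j k i) kyz ffunE.
have yi0 i : i != j -> y i = 0%N.
  by move=> /negbTE ij; have := coordE i; rewrite ij; lia.
have zi0 i : i != j -> z i = 0%N.
  by move=> /negbTE ij; have := coordE i; rewrite ij; lia.
have [|y0] := pselect (y = 0); first by left.
have [|z0] := pselect (z = 0); first by right.
have := axis_gap_coord_ge Sy yi0 y0; have := axis_gap_coord_ge Sz zi0 z0.
by have := coordE j; rewrite eqxx; lia.
Qed.

Lemma axis_gap_embedding_dim_ge p (j : 'I_p) q : (0 < q)%N ->
  (q <= embedding_dim (axis_gap_semigroup j q))%N.
Proof.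
move=> q_gt0; rewrite embedding_dimE.
have -> : q = size [seq std_basis j *+ k | k <- iota q q].
  by rewrite size_map size_iota.
apply: leq_set_size.
- exact/atoms_finite/carrier_affine.
- by rewrite (map_inj_uniq (@std_basis_mulrn_inj _ j)) iota_uniq.
move=> _ /mapP[k + ->]; rewrite mem_iota size_map size_iota => qk.
by apply: axis_gap_atom; lia.
Qed.

Lemma gaps_axis_gap p (j : 'I_p) q :
  gaps (axis_gap_semigroup j q) = axis_points j q.
Proof. exact: setCK. Qed.

Lemma axis_gap_genus_le p (j : 'I_p) q :
  (genus (axis_gap_semigroup j q) <= q - 1)%N.
Proof.
have -> : (q - 1)%N = size [seq std_basis j *+ k | k <- iota 1 (q - 1)].
  by rewrite size_map size_iota.
apply: set_size_leq; first exact: carrier_cofinite.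
move=> x; rewrite gaps_axis_gap => -[k kq ->].
by apply: map_f; rewrite mem_iota; lia.
Qed.

(** Translate 0 <= (l - k) x by k x. *)
Lemma monomial_order_mulrn p (le : rel (Np p)) (x : Np p) k l :
  monomial_order le -> (k <= l)%N -> le (x *+ k) (x *+ l).
Proof.
move=> [_ leD le0] kl; rewrite -(subnK kl) mulrnDr -[X in le X _]add0r.
exact: leD.
Qed.

(** On the multiples of e_j every monomial order agrees with the order of N, so (q - 1) e_j is the
    greatest gap. For the sequel it is enough to record that the Frobenius element exists and is a
    gap. *)
Lemma axis_gap_frobenius p (j : 'I_p) q (le : rel (Np p)) :
  (1 < q)%N -> monomial_order le ->
  exists2 f, frobenius le (axis_gap_semigroup j q) = Some f &
    axis_points j q f.
Proof.
move=> q_gt1 hmon; rewrite /frobenius gaps_axis_gap.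
case: xgetP => [_ -> [f [gf _] <-]|]; first by exists f.
(* The default [None] is excluded by exhibiting a greatest gap. *)
move=> /(_ (Some (std_basis j *+ (q - 1)))) [].
exists (std_basis j *+ (q - 1)) => //; split.
  by exists (q - 1)%N => //; lia.
by move=> _ [k kq ->]; apply: monomial_order_mulrn => //; lia.
Qed.

Lemma axis_gap_n_sporadic_gt0 p (j : 'I_p) q (le : rel (Np p)) :
  (1 < q)%N -> monomial_order le -> finitely_preceded le ->
  (0 < n_sporadic le (axis_gap_semigroup j q))%N.
Proof.
move=> q_gt1 hmon hfin; have [f fE gf] := axis_gap_frobenius j q_gt1 hmon.
have S0 := (axis_gap_submonoid j q).1.
apply: (@leq_set_size _ _ [:: 0]) => //.
  (* The sporadic set lies in the finite initial segment below f, so [set_size] really counts it. *)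
  apply: sub_finite_set (hfin f) => x [_] /=.
  by rewrite /before_frobenius fE.
(* 0 lies below f, and differs from it because f is a gap while 0 lies in S. *)
move=> _ /[!inE]/eqP->; split=> //=; rewrite /before_frobenius fE /strict.
have [_ _ ->] := hmon; apply/eqP => f0.
by apply: S0; rewrite f0.
Qed.

Theorem lemma12 (p q : nat) (j : 'I_p) (le : rel (Np p))
  (hp : (2 <= p)%N) (hq : (0 < q)%N)
  (hmon : monomial_order le) (hfin : finitely_preceded le) :
  extended_wilf le (axis_gap_semigroup j q).
Proof.
rewrite /extended_wilf /frobenius_number.
have := axis_gap_genus_le j q; have := axis_gap_embedding_dim_ge j hq.
set n := n_sporadic _ _; set e := embedding_dim _; set g := genus _ => qe gq.
suff : (n + g <= n * e)%N by lia.
(* The case q = 1 is separate because no element is sporadic there; g <= 0 and e >= 1 then settle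
   it. *)
have [q_gt1|q_le1] := ltnP 1 q; last by nia.
have : (0 < n)%N by exact: axis_gap_n_sporadic_gt0.
by nia.
Qed.
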